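(* For every real $\eta>0$ and every integer $\Delta\ge2$ there exist positive constants $\beta$ and $\kappa$ such that for all sufficiently large $n$, for every graph $H\in\mathcal{H}_2^{\beta n}((1-\eta)n,\Delta)$ and every $k\le\kappa(n/\log n)^{1/\Delta}$, every $k$-bounded edge-colouring of the complete graph $K_n$ is $H$-polychromatic.
   Context: A graph on $m$ vertices has bandwidth at most $b$ if there is a bijective labelling of its vertices by $1,\dots,m$ such that $|i-j|\le b$ for every edge $ij$. $\mathcal{H}_2^{b}(m,\Delta)$ denotes the class of all bipartite graphs on $m$ vertices with maximum degree at most $\Delta$ and bandwidth at most $b$. An edge colouring $\phi$ of $K_n$ is $k$-bounded if no colour is used on more than $k$ edges. A copy of $H$ in $K_n$ is polychromatic if no colour appears on more than one of its edges; $\phi$ is $H$-polychromatic if $K_n$ contains a polychromatic copy of $H$. *)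

(* Defs.v *)
From HB Require Import structures.
From mathcomp Require Import all_boot all_order all_algebra.
From mathcomp Require Import all_classical all_reals all_analysis.
Set Implicit Arguments. Unset Strict Implicit. Unset Printing Implicit Defensive.
Import Order.TTheory GRing.Theory Num.Theory.

Definition simple_graph (m : nat) (e : rel 'I_m) : Prop :=
  irreflexive e /\ symmetric e.

Definition bipartite (m : nat) (e : rel 'I_m) : Prop :=
  exists c : 'I_m -> bool, forall x y, e x y -> c x != c y.

Definition max_degree_le (m : nat) (e : rel 'I_m) (D : nat) : Prop :=
  forall v : 'I_m, #|[set u | e v u]| <= D.

(* bandwidth at most b (b real): a bijective labelling (here by 0..m-1, an
   irrelevant shift of 1..m) with |label x - label y| <= b on every edge *)
Definition bandwidth_le (R : realType) (m : nat) (e : rel 'I_m) (b : R) : Prop :=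
  exists s : 'I_m -> 'I_m, bijective s /\ forall x y, e x y ->
    (`|(s x)%:R - (s y)%:R| <= b)%R.

Definition in_H2 (R : realType) (m : nat) (e : rel 'I_m) (b : R) (D : nat) : Prop :=
  [/\ simple_graph e, bipartite e, max_degree_le e D & bandwidth_le e b].

(* Edges of K_n are the 2-element subsets of 'I_n; an edge colouring assigns
   a colour (a natural number) to each of them. *)
Definition is_edge_Kn (n : nat) (E : {set 'I_n}) : bool := #|E| == 2.

Definition k_bounded (n : nat) (phi : {set 'I_n} -> nat) (k : nat) : Prop :=
  forall c : nat, #|[set E : {set 'I_n} | is_edge_Kn E & phi E == c]| <= k.

Definition polychromatic_copy (n m : nat) (phi : {set 'I_n} -> nat)
    (e : rel 'I_m) (f : 'I_m -> 'I_n) : Prop :=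
  injective f /\
  forall x y x' y', e x y -> e x' y' -> [set x; y] != [set x'; y'] ->
    phi [set f x; f y] != phi [set f x'; f y'].

Definition H_polychromatic (n m : nat) (phi : {set 'I_n} -> nat) (e : rel 'I_m) : Prop :=
  exists f : 'I_m -> 'I_n, polychromatic_copy phi e f.

(* Main.v *)
Require Import Defs.
From HB Require Import structures.
From mathcomp Require Import all_boot all_order all_algebra.
From mathcomp Require Import all_classical all_reals all_analysis.
From mathcomp Require Import zify lra.
Import Order.TTheory GRing.Theory Num.Theory.

(** Embed H greedily, never reusing a colour, with d about delta * n.  A vertex of
   K_n is heavy if more than d of its edges carry colours used so far; whenever
   a vertex becomes heavy, the vertex of H placed there is unembedded.  With at
   most Delta * t colours after t steps there are O(k) heavy vertices, and each
   causes at most one unembedding, so t stays at most m + n and the process must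
   end with all of H embedded.  Two edges at a newly embedded vertex could share
   a colour; this is prevented by never placing two H-vertices with a common
   neighbour at a, b when more than d vertices w have phi(wa) = phi(wb), and by
   avoiding the O(k) vertices a that lie in more than d such pairs.  Then fewer
   than n vertices of K_n are forbidden at each step.  This works as
   soon as k <= kappa * n for a small kappa. *)

(** * General counting bounds on finite types *)

Lemma card_gt_mul_le_sum (T : finType) (g : T -> nat) (d : nat) :
  #|[set a | d < g a]| * d.+1 <= \sum_a g a.
Proof.
rewrite -sum_nat_const big_mkcond /=; apply: leq_sum => a _.
by rewrite inE; case: ltnP.
Qed.

Lemma card_bigcup_le (I T : finType) (A : {set I}) (F : I -> {set T}) (b : nat) :
  (forall i, i \in A -> #|F i| <= b) -> #|\bigcup_(i in A) F i| <= #|A| * b.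
Proof.
move=> Fb; rewrite -sum_nat_const.
elim/big_rec2: _ => [|i y B Ai IH]; first by rewrite cards0.
by rewrite (leq_trans (leq_card_setU _ _)) // leq_add // Fb.
Qed.

(** * Double counting in a [k]-bounded colouring *)

Section Embedding.

Variables (n : nat) (phi : {set 'I_n} -> nat) (k : nat).
Hypothesis phi_bounded : k_bounded phi k.

Lemma set2_injr (w : 'I_n) : {in [pred b | b != w] &, injective (fun b => [set w; b])}.
Proof.
move=> a b; rewrite !inE => aw _ /setP /(_ a).
by rewrite !inE eqxx orbT (negbTE aw) => /esym /eqP.
Qed.

(** The condition [w != a] matters: [[set a; a]] is a singleton, hence no edge, yet [phi] has a
    value there. *)
Definition colour_nbh (C : seq nat) (a : 'I_n) : {set 'I_n} :=
  [set w | (w != a) && (phi [set a; w] \in C)].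

Lemma card_coloured_edges (C : seq nat) :
  #|[set E : {set 'I_n} | is_edge_Kn E & phi E \in C]| <= size C * k.
Proof.
elim: C => [|c C IH].
  by rewrite leqn0 cards_eq0; apply/eqP/setP => E; rewrite !inE andbF.
rewrite mulSn; apply: leq_trans (leq_add (phi_bounded c) IH).
apply: leq_trans (leq_card_setU _ _); apply/subset_leq_card/fintype.subsetP => E.
by rewrite !inE => /andP[-> /orP[->|->]]; rewrite ?orbT.
Qed.

(** Double counting: each edge with a colour in [C] is seen once from each of its two ends. *)
Lemma sum_colour_nbh (C : seq nat) :
  \sum_a #|colour_nbh C a| <= 2 * (size C * k).
Proof.
pose S := [set E : {set 'I_n} | is_edge_Kn E & phi E \in C].
apply: (@leq_trans (\sum_a \sum_(E in S) (a \in E))).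
  apply: leq_sum => a _.
  rewrite -big_mkcondr sum1dep_card -(card_in_imset (f := fun b => [set a; b])).
    apply/subset_leq_card/fintype.subsetP => _ /imsetP[w] /[!inE] /andP[wa cw] ->.
    by rewrite !inE cw /is_edge_Kn cards2 (eq_sym a w) wa !eqxx.
  by apply: sub_in2 (@set2_injr a) => w; rewrite !inE => /andP[].
rewrite exchange_big /= mulnC.
apply: leq_trans (leq_mul (card_coloured_edges C) (leqnn 2)).
rewrite -sum_nat_const; apply: leq_sum => E; rewrite inE => /andP[/eqP E2 _].
by rewrite -big_mkcond sum1_card E2.
Qed.

Definition twins (a b : 'I_n) : {set 'I_n} :=
  [set w | [&& w != a, w != b & phi [set w; a] == phi [set w; b]]].

Lemma twinsC (a b : 'I_n) : twins a b = twins b a.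
Proof. by apply/setP => w; rewrite !inE andbCA (eq_sym (phi _)). Qed.

(** Sum over [w] first: for fixed [w], the edges [[set w; b]] that count all have the colour of
    [[set w; a]], so there are at most [k] of them. *)
Lemma sum_twins (a : 'I_n) : \sum_(b | b != a) #|twins a b| <= n * k.
Proof.
under eq_bigr do rewrite -sum1_card big_mkcond.
rewrite exchange_big /= -[n in n * k]card_ord -sum_nat_const.
apply: leq_sum => w _; rewrite -big_mkcondr sum1dep_card.
apply: leq_trans (phi_bounded (phi [set w; a])).
rewrite -(card_in_imset (f := fun b => [set w; b])).
  apply/subset_leq_card/fintype.subsetP => _ /imsetP[b] /[!inE] /and4P[ba wa wb /eqP ->] ->.
  by rewrite /is_edge_Kn cards2 wb !eqxx.
by apply: sub_in2 (@set2_injr w) => b; rewrite !inE (eq_sym b w) => /and4P[].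
Qed.

(** * Exceptional vertices of the complete graph, with threshold [d] *)

Variable d : nat.

Definition heavy (C : seq nat) : {set 'I_n} := [set a | d < #|colour_nbh C a|].

Definition twinned (a : 'I_n) : {set 'I_n} := [set b | (b != a) && (d < #|twins a b|)].

Definition overtwinned : {set 'I_n} := [set a | d < #|twinned a|].

Lemma twinnedC (a b : 'I_n) : (a \in twinned b) = (b \in twinned a).
Proof. by rewrite !inE twinsC eq_sym. Qed.

Lemma colour_nbhS {C C' : seq nat} (a : 'I_n) :
  {subset C <= C'} -> colour_nbh C a \subset colour_nbh C' a.
Proof.
by move=> CC'; apply/fintype.subsetP => w; rewrite !inE => /andP[-> /CC' ->].
Qed.

Lemma heavyS {C C' : seq nat} : {subset C <= C'} -> heavy C \subset heavy C'.
Proof.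
move=> CC'; apply/fintype.subsetP => a; rewrite !inE => /leq_trans; apply.
exact/subset_leq_card/colour_nbhS.
Qed.

Lemma card_heavy (C : seq nat) : #|heavy C| * d.+1 <= 2 * (size C * k).
Proof. exact: leq_trans (card_gt_mul_le_sum _ _ _) (sum_colour_nbh C). Qed.

Lemma card_twinned (a : 'I_n) : #|twinned a| * d.+1 <= n * k.
Proof.
apply: leq_trans (sum_twins a).
rewrite -sum_nat_const big_mkcond [X in _ <= X]big_mkcond /=.
by apply: leq_sum => b _; rewrite inE; case: eqP => //=; case: ltnP.
Qed.

(** Markov's inequality twice: once in [card_twinned] for each vertex, once for the sizes of the
    sets [twinned a]. *)
Lemma card_overtwinned : #|overtwinned| * d.+1 ^ 2 <= n ^ 2 * k.
Proof.
apply: (@leq_trans ((\sum_a #|twinned a|) * d.+1)).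
  by rewrite expnS expn1 mulnA leq_mul2r card_gt_mul_le_sum.
rewrite big_distrl /= expnS expn1 -mulnA -[X in _ <= X * _]card_ord -sum_nat_const.
by apply: leq_sum => a _; apply: card_twinned.
Qed.

(** * Partial embeddings and their extension by one vertex *)

Variables (m : nat) (e : rel 'I_m) (Delta : nat).
Hypotheses (e_simple : simple_graph e) (e_deg : max_degree_le e Delta).

Definition nbh (x : 'I_m) : {set 'I_m} := [set u | e x u].

(* [C] may contain colours that no longer occur on embedded edges. *)
Record partial_embedding (D : {set 'I_m}) (f : 'I_m -> 'I_n) (C : seq nat) : Prop := {
  pe_inj : {in D &, injective f};
  pe_col : {in D &, forall x y, e x y -> phi [set f x; f y] \in C};
  pe_poly : forall x y x' y', x \in D -> y \in D -> x' \in D -> y' \in D ->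
    e x y -> e x' y' -> phi [set f x; f y] = phi [set f x'; f y'] ->
    [set x; y] = [set x'; y'];
  pe_twin : {in D &, forall x y z, x != y -> e z x -> e z y -> f x \notin twinned (f y)};
  pe_over : {in D, forall x, f x \notin overtwinned}
}.

(** This is the unembedding move. It keeps [C], so the set of heavy vertices never shrinks. *)
Lemma partial_embeddingS (D D' : {set 'I_m}) f C :
  D' \subset D -> partial_embedding D f C -> partial_embedding D' f C.
Proof.
move=> /fintype.subsetP sD [inj col poly twin over]; split.
- exact: sub_in2 inj.
- exact: sub_in2 col.
- by move=> x y x' y' /sD ? /sD ? /sD ? /sD ?; apply: poly.
- exact: sub_in2 twin.
- exact: sub_in1 over.
Qed.

(** In [adm_twin] the common neighbour [z] need not be embedded: the condition prepares for the step
    that places [z]. [adm_heavy] ensures that [w], if it becomes heavy, does so only through the new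
    colours. *)
Record admissible (D : {set 'I_m}) (f : 'I_m -> 'I_n) (C : seq nat)
    (x : 'I_m) (w : 'I_n) : Prop := {
  adm_new : {in D, forall u, f u != w};
  adm_over : w \notin overtwinned;
  adm_heavy : w \notin heavy C;
  adm_col : {in D, forall u, e x u -> phi [set w; f u] \notin C};
  adm_poly : {in D &, forall u u', e x u -> e x u' ->
    phi [set w; f u] = phi [set w; f u'] -> u = u'};
  adm_twin : {in D, forall u z, e z x -> e z u -> w \notin twinned (f u)}
}.

Definition new_colours (D : {set 'I_m}) (f : 'I_m -> 'I_n) (x : 'I_m) (w : 'I_n) :=
  [seq phi [set w; f u] | u <- enum (nbh x :&: D)].

Lemma size_new_colours (D : {set 'I_m}) (f : 'I_m -> 'I_n) (x : 'I_m) (w : 'I_n) : size (new_colours D f x w) <= Delta.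
Proof.
rewrite size_map -cardE; apply: leq_trans (e_deg x).
exact/subset_leq_card/finset.subsetIl.
Qed.

(** Every new edge joins [x] to a vertex of [D]. A colour clash between an old and a new edge
    contradicts [adm_col], and one between two new edges is excluded by [adm_poly]. *)
Lemma partial_embedding_extend (D : {set 'I_m}) (f : 'I_m -> 'I_n) (C : seq nat) (x : 'I_m) (w : 'I_n) :
  x \notin D -> partial_embedding D f C -> admissible D f C x w ->
  partial_embedding (x |: D) [eta f with x |-> w] (C ++ new_colours D f x w).
Proof.
move=> xD [inj col poly twin over] [anew aover _ acol apoly atwin].
have [irr sym] := e_simple.
have fD u : u \in D -> [eta f with x |-> w] u = f u.
  by move=> uD /=; case: eqP => // ux; rewrite -ux uD in xD.
have fx : [eta f with x |-> w] x = w by rewrite /= eqxx.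
set g := [eta f with x |-> w] in fD fx *; clearbody g.
have edgeP y z : y \in x |: D -> z \in x |: D -> e y z ->
    (y \in D /\ z \in D) \/
    exists u, [/\ u \in D, e x u, [set y; z] = [set x; u] &
                  [set g y; g z] = [set w; f u]].
  case/setU1P => [->|yD] /setU1P [->|zD] eyz; first by rewrite irr in eyz.
  - by right; exists z; rewrite fx fD.
  - right; exists y; rewrite fx fD // [in LHS]finset.setUC sym; split=> //.
    by rewrite finset.setUC.
  - by left.
split.
- move=> y z /setU1P [->|yD] /setU1P [->|zD]; rewrite ?fx ?fD //.
  + by move=> /esym/eqP; rewrite (negbTE (anew _ zD)).
  + by move=> /eqP; rewrite (negbTE (anew _ yD)).
  + exact: inj.
- move=> y z yD zD eyz; rewrite mem_cat; case: (edgeP y z yD zD eyz).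
    by case=> {}yD {}zD; rewrite !fD // col.
  case=> u [uD exu _ ->]; apply/orP; right.
  by apply: map_f; rewrite mem_enum !inE exu.
- move=> y z y' z' yD zD yD' zD' eyz eyz'.
  case: (edgeP y z yD zD eyz) => [[{}yD {}zD]|[u [uD exu -> ->]]];
  case: (edgeP y' z' yD' zD' eyz') => [[{}yD' {}zD']|[u' [uD' exu' -> ->]]].
  + by rewrite !fD //; apply: poly.
  + by rewrite !fD // => E; case/negP: (acol _ uD' exu'); rewrite -E col.
  + by rewrite !fD // => E; case/negP: (acol _ uD exu); rewrite E col.
  + by move=> E; rewrite (apoly u u').
- move=> y z /setU1P [->|yD] /setU1P [->|zD] t; rewrite ?eqxx ?fx ?fD // => yz ey ez.
  + exact: atwin ey ez.
  + by rewrite twinnedC; apply: atwin ez ey.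
  + exact: twin ey ez.
- by move=> y /setU1P [->|yD]; rewrite ?fx ?fD // over.
Qed.

(** A vertex fails to be admissible only if it lies in one of six sets, and their sizes add up to
    less than [n]. *)
Lemma exists_admissible (D : {set 'I_m}) (f : 'I_m -> 'I_n) (C : seq nat) (x : 'I_m) :
  x \notin D -> partial_embedding D f C -> [disjoint f @: D & heavy C] ->
  #|heavy C| <= d -> #|overtwinned| <= d ->
  m + (2 + Delta + 2 * Delta ^ 2) * d <= n ->
  exists w, admissible D f C x w.
Proof.
move=> xD [inj col poly twin over] dis hd od mn.
have [irr sym] := e_simple.
pose N := nbh x :&: D.
have cN : #|N| <= Delta.
  by apply: leq_trans (e_deg x); apply/subset_leq_card/finset.subsetIl.
pose F1 := f @: D.
pose F2 := \bigcup_(u in N) colour_nbh C (f u).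
pose F3 := \bigcup_(u in N) \bigcup_(u' in N :\ u) twins (f u) (f u').
pose F4 := \bigcup_(z in nbh x) \bigcup_(u in nbh z :&: D) twinned (f u).
pose F := F1 :|: overtwinned :|: heavy C :|: F2 :|: F3 :|: F4.
(* Since [x] is outside [D] this bound is strict, and so is the total [#|F| < n]. *)
have cF1 : #|F1| < m.
  apply: leq_ltn_trans (leq_imset_card _ _) _.
  by have := max_card (x |: D); rewrite cardsU1 xD card_ord.
(* By [dis] no vertex in use is heavy. *)
have cF2 : #|F2| <= Delta * d.
  apply: leq_trans (leq_mul cN (leqnn d)); apply: card_bigcup_le => u.
  rewrite inE => /andP[_ uD]; rewrite leqNgt; apply/negP => h.
  move/pred0P: dis => /(_ (f u)) /=; rewrite imset_f //= inE h //.
(* Here [u] and [u'] have the common neighbour [x], so [pe_twin] bounds the twins of their images by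
   [d]. *)
have cF3 : #|F3| <= Delta ^ 2 * d.
  rewrite expnS expn1 -mulnA; apply: leq_trans (leq_mul cN (leqnn _)).
  apply: card_bigcup_le => u /setIP[]; rewrite inE => exu uD.
  apply: leq_trans (leq_mul (leq_trans (subset_leq_card (finset.subsetDl _ _)) cN) (leqnn d)).
  apply: card_bigcup_le => u'; rewrite !inE => /and3P[uu' exu' uD'].
  have := twin _ _ uD' uD _ uu' exu' exu; rewrite inE negb_and negbK -leqNgt.
  by case/orP => // /eqP /inj E; rewrite E // eqxx in uu'.
have cF4 : #|F4| <= Delta ^ 2 * d.
  rewrite expnS expn1 -mulnA; apply: leq_trans (leq_mul (e_deg x) (leqnn _)).
  apply: card_bigcup_le => z _.
  apply: leq_trans (leq_mul (leq_trans (subset_leq_card (finset.subsetIl _ _)) (e_deg z)) (leqnn d)).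
  by apply: card_bigcup_le => u /setIP[_ uD]; have := over _ uD; rewrite inE -leqNgt.
have cF : #|F| < n.
  have cU (A B : {set 'I_n}) a b : #|A| <= a -> #|B| <= b -> #|A :|: B| <= a + b.
    by move=> Aa Bb; apply: leq_trans (leq_card_setU _ _) _; apply: leq_add.
  have : #|F| <= #|F1| + d + d + Delta * d + Delta ^ 2 * d + Delta ^ 2 * d.
    by do 5! apply: (cU) => //.
  move/leq_ltn_trans; apply; apply: leq_trans mn.
  by move: #|F1| cF1 => c; lia.
have [w wF] : exists w, w \notin F.
  apply/existsP; rewrite -negb_forall; apply/negP => /forallP FT.
  by move: cF; rewrite (eq_card (B := 'I_n)) ?card_ord ?ltnn // => w; rewrite FT.
move: wF; rewrite !inE !negb_or -!andbA => /andP[w1 /and5P[w2 w3 w4 w5 w6]].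
have wf u : u \in D -> f u != w.
  by move=> uD; apply: contraNneq w1 => <-; apply: imset_f.
exists w; split=> //.
- by rewrite inE.
- by rewrite inE.
- move=> u uD exu; apply: contra w4 => uC; apply/finset.bigcupP; exists u; rewrite ?inE ?exu //.
  by rewrite eq_sym wf // finset.setUC.
- move=> u u' uD uD' exu exu' E; apply/eqP; apply: contraNT w5 => uu'.
  apply/finset.bigcupP; exists u; rewrite ?inE ?exu //.
  apply/finset.bigcupP; exists u'; rewrite ?inE ?exu' 1?eq_sym ?uu' //.
  by rewrite !(eq_sym w) !wf // E eqxx.
- move=> u uD z ezx ezu; apply: contra w6 => ww.
  apply/finset.bigcupP; exists z; first by rewrite inE sym.
  by apply/finset.bigcupP; exists u => //; rewrite !inE ezu.
Qed.

(** * The greedy process with unembedding *)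

Hypothesis heavy_room : 4 * (Delta * n * k) <= d * d.+1.
Hypothesis overtwinned_room : n ^ 2 * k <= d * d.+1 ^ 2.
Hypothesis room : m + (2 + Delta + 2 * Delta ^ 2) * d <= n.

Lemma embedding_full f C : partial_embedding [set: 'I_m] f C -> H_polychromatic phi e.
Proof.
case=> inj _ poly _ _; exists f; split; first by move=> x y; apply: inj; rewrite inE.
move=> x y x' y' exy exy'; apply: contraNneq => E; apply/eqP.
by apply: poly E => //; rewrite inE.
Qed.

(* After t embedding steps, at most one vertex has been unembedded for each
   heavy vertex of K_n, because heaviness is monotone in the set of colours. *)
Lemma greedy_steps (t : nat) : H_polychromatic phi e \/
  exists D f C, [/\ partial_embedding D f C, [disjoint f @: D & heavy C],
    size C <= Delta * t & t <= #|D| + #|heavy C|].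
Proof.
have le_mn : m <= n by apply: leq_trans room; apply: leq_addr.
elim: t => [|t [P|[D [f [C [emb dis sC tD]]]]]]; [|by left|].
  (* Nothing is embedded yet; the inclusion map is only a default value for [f]. *)
  right; exists finset.set0, (widen_ord le_mn), [::].
  split; rewrite ?imset0 //; last by apply/pred0P => a; rewrite /= inE.
  by split=> x; rewrite ?inE // => y; rewrite inE.
have [DT|/fintype.subsetPn [x _ xD]] := boolP (finset.setT \subset D).
  by left; apply: (@embedding_full f C); move: DT; rewrite finset.subTset => /eqP <-.
right.
have hd : #|heavy C| <= d.
  rewrite -(leq_pmul2r (ltn0Sn d)); apply: leq_trans heavy_room.
  apply: leq_trans (card_heavy C) _.
  have cD : #|D| <= m by rewrite -[X in _ <= X]card_ord max_card.
  have ch : #|heavy C| <= n by rewrite -[X in _ <= X]card_ord max_card.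
  (* From [t <= #|D| + #|heavy C| <= m + n]. With the 2 of [card_heavy] this gives the factor 4 in
     [heavy_room]. *)
  have tn : t <= 2 * n by lia.
  have := leq_mul (leq_trans sC (leq_mul (leqnn Delta) tn)) (leqnn k); lia.
have od : #|overtwinned| <= d.
  have d2 : 0 < d.+1 ^ 2 by rewrite expn_gt0.
  rewrite -(leq_pmul2r d2); exact: leq_trans card_overtwinned overtwinned_room.
have [w adm] := exists_admissible _ _ _ _ xD emb dis hd od room.
set C' := C ++ new_colours D f x w; set g := [eta f with x |-> w].
have sCC' : {subset C <= C'} by move=> c cC; rewrite mem_cat cC.
(* Unembed whatever sits on a heavy vertex, possibly [x] itself. *)
pose D' := [set y in x |: D | g y \notin heavy C'].
have emb' := partial_embedding_extend _ _ _ _ _ xD emb adm.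
exists D', g, C'; split.
- by apply: partial_embeddingS emb'; apply/fintype.subsetP => y; rewrite inE => /andP[].
- apply/pred0P => v /=; apply/negP => /andP[/imsetP[y /setIdP[_ gy] ->]].
  by rewrite (negbTE gy).
- by rewrite size_cat mulnS addnC leq_add // size_new_colours.
have cD : #|x |: D| = #|D|.+1 by rewrite cardsU1 xD.
(* [g] sends the unembedded vertices injectively to newly heavy ones: old images were not heavy by
   [dis], nor was [w] by [adm_heavy]. So each loss in [#|D|] is offset by a gain in [#|heavy C|]. *)
have cR : #|(x |: D) :\: D'| <= #|heavy C' :\: heavy C|.
  rewrite -(card_in_imset (f := g)); last first.
    by apply: sub_in2 (pe_inj _ _ _ emb') => y; rewrite inE => /andP[].
  apply/subset_leq_card/fintype.subsetP => _ /imsetP[y /finset.setDP[yD yD'] ->].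
  rewrite finset.in_setD; move: yD'; rewrite inE yD /= negbK => ->; rewrite andbT.
  case/setU1P: yD => [->|yD]; first by rewrite /g /= eqxx (adm_heavy _ _ _ _ _ adm).
  rewrite /g /=; case: eqP => [yx|_]; first by rewrite -yx yD in xD.
  by apply/negP => fy; move/pred0P: dis => /(_ (f y)) /=; rewrite imset_f // fy.
have sD : D' \subset x |: D by apply/fintype.subsetP => y; rewrite inE => /andP[].
move: cR (subset_leq_card sD) (subset_leq_card (heavyS sCC')).
rewrite !finset.cardsD (finset.setIidPr sD) (finset.setIidPr (heavyS sCC')) cD; lia.
Qed.

(** After [m + n + 1] steps the invariant would exceed the trivial bound
    [#|D| + #|heavy C| <= m + n]. *)
Lemma greedy_embedding : H_polychromatic phi e.
Proof.
have [//|[D [f [C [_ _ _]]]]] := greedy_steps (m + n).+1.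
rewrite ltnNge leq_add //; first by rewrite -[X in _ <= X]card_ord max_card.
by rewrite -[X in _ <= X]card_ord max_card.
Qed.

End Embedding.

(** * Choice of the constants and passage to real inequalities *)

Local Open Scope ring_scope.

(** Reduces the bound on [k] to [k <= kappa * n]. For [x] at least [expR 1], [ln x] is at least 1,
    and an exponent at most 1 does not increase a base at least 1. *)
Lemma powR_inv_div_ln_le (R : realType) (x : R) (D : nat) :
  expR 1 <= x -> (0 < D)%N -> (x / ln x) `^ D%:R^-1 <= x.
Proof.
move=> ex D0.
have x1 : 1 <= x by apply: le_trans ex; rewrite -expR0 ler_expR.
have x0 : 0 < x by apply: lt_le_trans x1.
have ln1 : 1 <= ln x by rewrite -[X in X <= _]expRK ler_ln // ?posrE ?expR_gt0.
have q0 : 0 <= x / ln x by rewrite divr_ge0 // ltW // (lt_le_trans ltr01).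
have qx : x / ln x <= x by rewrite ler_piMr ?(ltW x0) // invf_le1 // (lt_le_trans ltr01).
apply: (@le_trans _ _ (x `^ D%:R^-1)).
  by rewrite ge0_ler_powR ?nnegrE ?invr_ge0 ?ler0n // ltW.
rewrite -[X in _ <= X]powRr1 ?(ltW x0) //; apply: ler_powR => //.
by rewrite invf_le1 ?ler1n ?ltr0n.
Qed.

Theorem theorem3p1 (R : realType) (eta : R) (Delta : nat) :
  0 < eta -> (2 <= Delta)%N ->
  exists beta kappa : R, 0 < beta /\ 0 < kappa /\
  exists N : nat, forall n : nat, (N <= n)%N ->
  forall (m : nat) (e : rel 'I_m),
    (* m = floor((1 - eta) n) *)
    m%:R <= (1 - eta) * n%:R -> (1 - eta) * n%:R < m.+1%:R ->
    in_H2 e (beta * n%:R) Delta ->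
  forall k : nat, k%:R <= kappa * ((n%:R / ln (n%:R : R)) `^ (Delta%:R^-1)) ->
  forall phi : {set 'I_n} -> nat, k_bounded phi k -> H_polychromatic phi e.
Proof.
move=> eta0 Delta2.
pose K : nat := (2 + Delta + 2 * Delta ^ 2)%N.
have K1 : 1 <= K%:R :> R by rewrite ler1n.
have De0 : 0 < Delta%:R :> R by rewrite ltr0n (leq_trans _ Delta2).
(* Chosen so that the [K * d] extra forbidden vertices fit into the [eta * n] spare ones. *)
pose delta : R := eta / K%:R.
have delta0 : 0 < delta by rewrite divr_gt0 // (lt_le_trans ltr01).
(* The cube comes from [overtwinned_room], where [n ^ 2 * k] is compared with about [d ^ 3]; the
   factor [Delta] comes from [heavy_room]. *)
pose kappa : R := delta ^+ 3 / (16 * Delta%:R).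
have kappa0 : 0 < kappa by rewrite divr_gt0 ?exprn_gt0 // mulr_gt0 // ltr0n.
exists 1, kappa; split=> //; split=> //.
(* The first bound gives [2 <= delta * n], so that rounding down to [d] loses at most half; the
   second makes [ln n] at least 1. *)
exists (maxn (Num.trunc (2 / delta)).+1 (Num.trunc (expR 1 : R)).+1).
move=> n; rewrite geq_max => /andP[nd ne] m e mn _ [simple _ deg _] k kn phi phik.
have truncn_lt (x : R) : (Num.trunc x < n)%N -> x <= n%:R.
  by move=> h; apply/ltW; apply: lt_le_trans (truncnS_gt x) _; rewrite ler_nat.
have {nd} nd : 2 <= delta * n%:R by rewrite mulrC -ler_pdivrMr // truncn_lt.
have {ne} ne : expR 1 <= n%:R :> R by apply: truncn_lt.
have n0 : 0 < n%:R :> R by apply: lt_le_trans ne; apply: expR_gt0.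
have kn' : k%:R <= kappa * n%:R.
  apply: le_trans kn _; rewrite ler_pM2l // powR_inv_div_ln_le //.
  exact: leq_trans Delta2.
(* A graph on [m] vertices with [0 <= m <= (1 - eta) * n] exists only for such [eta]; hence
   [delta <= 1], and [delta ^+ 3] may be replaced by [delta ^+ 2] for [heavy_room]. *)
have eta1 : eta <= 1.
  have : 0 <= (1 - eta) * n%:R by apply: le_trans mn; apply: ler0n.
  by rewrite pmulr_lge0 // subr_ge0.
have delta1 : delta <= 1.
  by rewrite ler_pdivrMr ?mul1r ?(le_trans eta1) // (lt_le_trans ltr01).
pose d := Num.trunc (delta * n%:R).
have dle : d%:R <= delta * n%:R by rewrite truncn_le // ltW // mulr_gt0.
have dgt : delta * n%:R < d.+1%:R by apply: truncnS_gt.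
have dge : delta * n%:R / 2 <= d%:R by move: dgt; rewrite -natr1; lra.
have kD : 16 * Delta%:R * k%:R <= delta ^+ 3 * n%:R.
  move: kn'; rewrite /kappa mulrAC ler_pdivlMr ?mulr_gt0 //.
  by rewrite mulrC.
apply: (@greedy_embedding n phi k phik d m e Delta simple deg).
- rewrite -(ler_nat R) !natrM; apply: le_trans (ler_pM _ _ dge (ltW dgt)).
  + have kD' : 16 * (Delta%:R * k%:R) <= delta ^+ 2 * n%:R.
      rewrite mulrA; apply: le_trans kD _; rewrite ler_pM2r // exprS.
      by rewrite ler_piMl // exprn_ge0 // ltW.
    have := ler_wpM2r (ltW n0) kD'; have := sqr_ge0 (delta * n%:R); lra.
  + by rewrite divr_ge0 // ltW // mulr_gt0.
  + by rewrite ltW // mulr_gt0.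
- rewrite -(ler_nat R) !natrM -!expr2.
  apply: (@le_trans _ _ ((delta * n%:R / 2) * (delta * n%:R) ^+ 2)).
    have kD' : 16 * k%:R <= delta ^+ 3 * n%:R.
      apply: le_trans kD; rewrite ler_wpM2r // ler_peMr // ler1n.
      exact: leq_trans Delta2.
    have := ler_wpM2l (sqr_ge0 n%:R) kD'.
    have := exprn_ge0 3 (ltW (mulr_gt0 delta0 n0)); lra.
  apply: ler_pM => //.
  + by rewrite divr_ge0 // ltW // mulr_gt0.
  + exact: sqr_ge0.
  + by rewrite ler_pXn2r // ?nnegrE ?ler0n // ltW // mulr_gt0.
- rewrite -(ler_nat R) natrD natrM -/K.
  have : K%:R * d%:R <= eta * n%:R.
    apply: le_trans (ler_wpM2l (ler0n _ K) dle) _.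
    by rewrite mulrA /delta mulrCA divff ?mulr1 // gt_eqF // (lt_le_trans ltr01).
  move: mn; lra.
Qed.
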